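(* Let $d\in\mathbf{N}I$ and let $\omega,\omega'\in\Omega_d$. If $\omega\le\omega'$, then $\mathcal{E}_\omega\supset\mathcal{E}_{\omega'}$.
   Context: The ground field $K$ is algebraically closed of characteristic $0$, and $Q$ is a finite quiver without oriented cycles with vertex set $I$. $\mathbf{N}I$ is the set of vectors with nonnegative integer coordinates in the free abelian group on symbols $\sigma_i$ ($i\in I$). For $d\in\mathbf{N}I$, $R_d=\bigoplus_{\alpha:i\to j}\mathrm{Hom}_K(K^{d_i},K^{d_j})$ is the variety of representations of $Q$ of dimension vector $d$. For $\mathcal{A}\subset R_d$, $\mathcal{B}\subset R_e$, the set $\mathcal{A}*\mathcal{B}\subset R_{d+e}$ consists of all $X\in R_{d+e}$ for which there is an exact sequence of representations $0\to N\to X\to M\to 0$ with $M\in\mathcal{A}$, $N\in\mathcal{B}$; this operation is associative. $\Omega$ is the set of finite words in the alphabet $I$; for $\omega=(i_1\ldots i_s)$ we put $|\omega|=\sigma_{i_1}+\cdots+\sigma_{i_s}$ and $\mathcal{E}_\omega:=R_{\sigma_{i_1}}*\cdots*R_{\sigma_{i_s}}\subset R_{|\omega|}$. $\Omega_d$ is the set of words $\omega$ with $|\omega|=d$. A total ordering on $I$ is fixed such that the existence of an arrow from $i$ to $j$ implies $i<j$. For $\omega,\omega'\in\Omega_d$ one says $\omega\le\omega'$ if there is a sequence of words $\omega=\omega_0,\omega_1,\ldots,\omega_t=\omega'$ such that for each $k=1,\ldots,t$ there exist words $\omega_l,\omega_r\in\Omega$ and vertices $i<j$ in $I$ with $\omega_{k-1}=\omega_l\,(ij)\,\omega_r$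 and $\omega_k=\omega_l\,(ji)\,\omega_r$. *)

(* Defs.v *)
From HB Require Import structures.
From mathcomp Require Import all_boot all_order all_algebra.
From mathcomp Require Import classical_sets.

Set Implicit Arguments.
Unset Strict Implicit.
Unset Printing Implicit Defensive.

Import Order.TTheory GRing.Theory.

Local Open Scope ring_scope.
Local Open Scope classical_set_scope.

Record quiver (I : finType) := Quiver {
  arrow : finType;
  src : arrow -> I;
  tgt : arrow -> I }.

(* [cycle] holds of [:: a] iff a is a loop, and of [::] always. *)
Definition acyclic_quiver (I : finType) (Q : quiver I) : Prop :=
  forall c : seq (arrow Q), cycle (fun a b => tgt a == src b) c -> c = [::].

Notation dimvec I := {ffun I -> nat}.

Section Representations.
Variables (K : fieldType) (I : finType) (Q : quiver I).

(* K^n is 'rV[K]_n: the matrix of an arrow acts by right multiplication on row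
   vectors, so Hom(K^m, K^n) is 'M[K]_(m, n). *)
Definition rep (d : dimvec I) : Type :=
  forall a : arrow Q, 'M[K]_(d (src a), d (tgt a)).

Definition rep_hom (d e : dimvec I) (X : rep d) (Y : rep e)
    (f : forall i : I, 'M[K]_(d i, e i)) : Prop :=
  forall a : arrow Q, X a *m f (tgt a) = f (src a) *m Y a.

(* 0 -> N -f-> X -g-> M -> 0 is exact. *)
Definition short_exact (e x d : dimvec I) (N : rep e) (X : rep x) (M : rep d)
    (f : forall i : I, 'M[K]_(e i, x i))
    (g : forall i : I, 'M[K]_(x i, d i)) : Prop :=
  [/\ rep_hom N X f, rep_hom X M g &
    forall i : I,
      [/\ row_free (f i), (f i == kermx (g i))%MS & row_full (g i)]].

Definition star (d e : dimvec I) (A : set (rep d)) (B : set (rep e)) :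
    set (rep (d + e)) :=
  [set X | exists M : rep d, exists N : rep e,
     [/\ A M, B N & exists f, exists g, short_exact N X M f g]].

End Representations.

Section Words.
Variable I : finType.

Definition sigma (i : I) : dimvec I := [ffun j => (j == i : nat)].

(* A fixpoint rather than a \sum, so that [wdim (i :: w)] is convertible to the
   dimension vector of the product in [word_set]. *)
Fixpoint wdim (w : seq I) : dimvec I :=
  if w is i :: w' then sigma i + wdim w' else 0.

Lemma wdimE (w : seq I) : wdim w = \sum_(i <- w) sigma i.
Proof. by elim: w => [|i w IHw]; rewrite ?big_nil ?big_cons //= IHw. Qed.

Variables (K : fieldType) (Q : quiver I).

(* The product is bracketed to the right and ends with the unit R_0 = {0}. *)
Fixpoint word_set (w : seq I) : set (rep K Q (wdim w)) :=
  match w return set (rep K Q (wdim w)) with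
  | [::] => [set: rep K Q 0]
  | i :: w' => star [set: rep K Q (sigma i)] (@word_set w')
  end.

(* E_w as a subset of R_d when |w| = d. *)
Definition E_ (d : dimvec I) (w : seq I) (hw : wdim w = d) : set (rep K Q d) :=
  ecast x (set (rep K Q x)) hw (@word_set w).

End Words.

Arguments word_set {I} K Q w _.
Arguments E_ {I} K Q {d w} hw _.

Definition word_step (disp : Order.disp_t) (I : orderType disp)
    (w w' : seq I) : Prop :=
  exists wl wr : seq I, exists i j : I,
    [/\ (i < j)%O, w = wl ++ [:: i; j] ++ wr & w' = wl ++ [:: j; i] ++ wr].

Definition word_le (disp : Order.disp_t) (I : orderType disp)
    (w w' : seq I) : Prop :=
  exists (t : nat) (u : nat -> seq I),
    [/\ u 0%N = w, u t = w' &
      forall k : nat, (k < t)%N -> word_step (u k) (u k.+1)].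

(* Main.v *)
Require Import Defs.
From HB Require Import structures.
From mathcomp Require Import all_boot all_order all_algebra.
From mathcomp Require Import classical_sets.

Set Implicit Arguments.
Unset Strict Implicit.
Unset Printing Implicit Defensive.

Import Order.TTheory GRing.Theory.

Local Open Scope ring_scope.
Local Open Scope classical_set_scope.

(** A representation lies in E_w exactly when it has a chain of
    subrepresentations, descending from the whole to 0, whose successive
    quotients are the simples S_i for the letters i of w, read from the left.
    The order being generated by swaps inside a word, it is enough to turn a
    chain X > N1 > N2 with X / N1 = S_j and N1 / N2 = S_i, where i < j, into a
    chain X > N1' > N2 with the two quotients exchanged.  Take N1' equal to N2
    at the vertex i and to X at every other vertex.  It is stable under an arrow
    a : k -> i because k < i < j: there N2 and X coincide at k, so X_a maps all
    of X_k into N2_i; at the other arrows there is nothing to check.  In other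
    words X / N2 is split because no arrow goes from j to i, so it also has S_i
    as a quotient, with kernel S_j.

    The predicate [filtered] expresses the chain for representations of an
    arbitrary dimension vector, with no cast along an equality of dimensions;
    [filteredP] identifies it with E_w, and [filtered_swap] is the exchange. *)

Section MatrixLemmas.
Variable K : fieldType.

Lemma row_free_rank_eq (m n p : nat) (U : 'M[K]_(p, n)) :
  \rank U = m -> exists V : 'M[K]_(m, n), row_free V /\ (V :=: U)%MS.
Proof.
move=> <-; exists (row_base U); split; first exact: row_base_free.
exact: eq_row_base.
Qed.

Lemma row_free_full (m n : nat) (A : 'M[K]_(m, n)) :
  row_free A -> n = m -> row_full A.
Proof. by move=> /eqP rkA nm; apply/eqP; rewrite rkA nm. Qed.

Lemma row_free_coker (n p q : nat) (A : 'M[K]_(p, n)) :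
    row_free A -> n = (q + p)%N ->
  exists g : 'M[K]_(n, q), (A == kermx g)%MS /\ row_full g.
Proof.
move=> /eqP rkA en.
have rkC : \rank (cokermx A) = q by rewrite mxrank_coker rkA en addnK.
have [B eB rfB] : exists2 g : 'M[K]_(n, q), A *m g = 0 & row_full g.
  case: q / rkC {en}; exists (col_base (cokermx A)); last exact: col_base_full.
  apply: (row_free_inj (row_base_free (cokermx A))).
  by rewrite -mulmxA mulmx_base mulmx_coker mul0mx.
exists B; split => //; have sAB : (A <= kermx B)%MS by rewrite sub_kermx eB.
rewrite -(mxrank_leqif_eq sAB) rkA mxrank_ker (eqP rfB).
by rewrite en addnC addnK.
Qed.

End MatrixLemmas.

Section Filtrations.
Variables (K : fieldType) (disp : Order.disp_t) (I : finOrderType disp).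
Variable Q : quiver I.
Hypothesis ordQ : forall a : arrow Q, (src a < tgt a)%O.

Lemma sigma_neq (i k : I) : k != i -> sigma i k = 0%N.
Proof. by rewrite /sigma ffunE => /negPf->. Qed.

Lemma dimvecD (d e : dimvec I) (k : I) : (d + e) k = (d k + e k)%N.
Proof. by rewrite ffunE. Qed.

(** Only the subobjects of the chain are recorded: by [simple_quotient] the
    dimension of a quotient determines it. *)
Fixpoint filtered (w : seq I) (d : dimvec I) (X : rep K Q d) : Prop :=
  match w with
  | [::] => d = 0
  | i :: w' => exists (e : dimvec I) (N : rep K Q e)
                 (f : forall k, 'M[K]_(e k, d k)),
      [/\ d = sigma i + e, rep_hom N X f, forall k, row_free (f k)
        & filtered w' N]
  end.

(** A quotient of dimension vector sigma i carries the zero maps, since every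
    arrow has an endpoint other than i, where the quotient vanishes.  For the
    projection to be a morphism, X_a must land in N at an arrow a into i, which
    holds because N is all of X at the source of a. *)
Lemma simple_quotient (i : I) (e d : dimvec I) (N : rep K Q e) (X : rep K Q d)
    (f : forall k, 'M[K]_(e k, d k)) :
    d = sigma i + e -> rep_hom N X f -> (forall k, row_free (f k)) ->
  exists (M : rep K Q (sigma i)) g, short_exact N X M f g.
Proof.
move=> ed homf freef.
have edk k : d k = (sigma i k + e k)%N by rewrite ed dimvecD.
have [g gP] := fin_all_exists (fun k => row_free_coker (freef k) (edk k)).
exists (fun a => 0), g; split=> //; last by move=> k; case: (gP k).
move=> a; rewrite mulmx0; have [ti | tNi] := eqVneq (tgt a) i; last first.
  apply/matrixP=> x y; have := ltn_ord y.
  by rewrite [X in (_ < X)%N]sigma_neq.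
have sNi : src a != i by rewrite -ti (lt_eqF (ordQ a)).
have fullf : row_full (f (src a)).
  by apply: row_free_full; rewrite ?freef // edk sigma_neq.
apply: (row_full_inj fullf); rewrite mulmx0 mulmxA -homf -mulmxA.
have [/andP[sfk _] _] := gP (tgt a).
by move: sfk; rewrite sub_kermx => /eqP->; rewrite mulmx0.
Qed.

Lemma filteredP (d : dimvec I) (w : seq I) (hw : wdim w = d) (X : rep K Q d) :
  E_ K Q hw X <-> filtered w X.
Proof.
case: d / hw X; rewrite /E_ /=.
elim: w => [|i w IHw] X //=; split.
- move=> [M [N [_ wN [f [g [homf _ exfg]]]]]]; exists (wdim w), N, f.
  by split=> // [k|]; [case: (exfg k) | apply/IHw].
- move=> [e [N [f [ed homf freef wN]]]].
  have ee : wdim w = e.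
    apply/ffunP=> k; move/ffunP/(_ k): (ed); rewrite !dimvecD.
    exact: addnI.
  case: e / ee in N f ed homf freef wN *.
  have [M [g ex]] := simple_quotient ed homf freef.
  by exists M, N; split=> //; [apply/IHw | exists f, g].
Qed.

(** The maps of Y are those of X, and g is h, both read in the coordinates of
    the bases V: multiplying by [pinvmx] of V solves for these coordinates. *)
Lemma subrep_factor (e d d' : dimvec I) (N : rep K Q e) (X : rep K Q d)
    (h : forall k, 'M[K]_(e k, d k)) (V : forall k, 'M[K]_(d' k, d k)) :
    rep_hom N X h -> (forall k, row_free (V k)) ->
    (forall k, (h k <= V k)%MS) ->
    (forall a : arrow Q, (V (src a) *m X a <= V (tgt a))%MS) ->
  exists (Y : rep K Q d') (g : forall k, 'M[K]_(e k, d' k)),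
    [/\ rep_hom Y X V, rep_hom N Y g & forall k, g k *m V k = h k].
Proof.
move=> homh freeV shV stV.
exists (fun a => V (src a) *m X a *m pinvmx (V (tgt a))).
exists (fun k => h k *m pinvmx (V k)).
have gV k : h k *m pinvmx (V k) *m V k = h k by rewrite mulmxKpV.
split=> // a; first by rewrite mulmxKpV.
apply: (row_free_inj (freeV (tgt a))).
rewrite -[LHS]mulmxA gV -[RHS]mulmxA mulmxKpV // [RHS]mulmxA gV.
exact: homh.
Qed.

(** The quotient of X by the second term N of its chain has dimension vector
    sigma i + sigma j; the subrepresentation equal to N at i and to X elsewhere
    lifts its summand S_j. *)
Lemma filtered_swap (i j : I) (w : seq I) (d : dimvec I) (X : rep K Q d) :
  (i < j)%O -> filtered [:: j, i & w] X -> filtered [:: i, j & w] X.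
Proof.
move=> ij [e1 [N1 [f1 [d1 hom1 free1 [e [N [f2 [d2 hom2 free2 wN]]]]]]]].
pose h k := f2 k *m f1 k.
have homh : rep_hom N X h.
  by move=> a; rewrite /h mulmxA hom2 -!mulmxA hom1.
have freeh k : row_free (h k).
  by rewrite /row_free /h mxrankMfree ?free1 //; apply: free2.
have dE : d = sigma i + (sigma j + e) by rewrite d1 d2 addrCA.
have dk k : d k = (sigma i k + (sigma j k + e k))%N by rewrite dE !dimvecD.
pose d' := sigma j + e.
have d'k k : d' k = (sigma j k + e k)%N by rewrite dimvecD.
(* the middle term of the new chain: N at i, X elsewhere *)
pose U k : 'M[K]_(d k) := if k == i then <<h k>>%MS else 1%:M.
have rkU k : \rank (U k) = d' k.
  rewrite /U d'k; have [-> | kNi] := eqVneq k i.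
    by rewrite genmxE (eqP (freeh i)) sigma_neq // lt_eqF.
  by rewrite mxrank1 dk (sigma_neq kNi).
have [V VP] := fin_all_exists (fun k => row_free_rank_eq (rkU k)).
have freeV k : row_free (V k) by case: (VP k).
have VU k : (V k :=: U k)%MS by case: (VP k).
have shV k : (h k <= V k)%MS.
  by rewrite VU /U; case: eqP => _; rewrite ?genmxE ?submx1.
have stV a : (V (src a) *m X a <= V (tgt a))%MS.
  rewrite VU /U; have [ti | _] := eqVneq (tgt a) i; last exact: submx1.
  have si : (src a < i)%O by rewrite -ti ordQ.
  have fullh : row_full (h (src a)).
    apply: row_free_full; first exact: freeh.
    by rewrite dk !sigma_neq // lt_eqF // (lt_trans si).
  rewrite genmxE (submx_trans (submxMr _ (submx_full _ fullh))) //.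
  by rewrite -homh submxMl.
have [Y [g [homV homg gV]]] := subrep_factor homh freeV shV stV.
exists d', Y, V; split=> //; exists e, N, g; split=> // k.
by rewrite /row_free -(mxrankMfree _ (freeV k)) gV; apply: freeh.
Qed.

Lemma filtered_step (w w' : seq I) (d : dimvec I) (X : rep K Q d) :
  word_step w w' -> filtered w' X -> filtered w X.
Proof.
move=> [wl [wr [i [j [ij -> ->]]]]].
elim: wl d X => [|k wl IHwl] d X /=; first exact: filtered_swap.
move=> [e [N [f [ed homf freef wN]]]].
by exists e, N, f; split=> //; apply: IHwl.
Qed.

End Filtrations.

Theorem lemma3p7 (K : closedFieldType) (charK : [pchar K] =i pred0)
    (disp : Order.disp_t) (I : finOrderType disp) (Q : quiver I)
    (acycQ : acyclic_quiver Q)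
    (ordQ : forall a : arrow Q, (src a < tgt a)%O)
    (d : dimvec I) (w w' : seq I) (hw : wdim w = d) (hw' : wdim w' = d) :
  word_le w w' -> E_ K Q hw' `<=` E_ K Q hw.
Proof.
move=> [t [u [u0 ut ustep]]] X /(filteredP ordQ); rewrite -{}ut => utX.
apply/(filteredP ordQ); rewrite -{}u0.
elim: t ustep utX => [|t IHt] ustep utX //.
apply: IHt => [k kt|]; first by apply: ustep; apply: ltnW.
by apply: (filtered_step ordQ) utX; apply: ustep.
Qed.
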